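(* Let $j\ge 2$ be an integer and let $G$ be a connected graph with non-empty bridge set $B(G)$. If there is no bridge $b\in B(G)$ such that $G-\{b\}$ has a component that is bipartite or isomorphic to $K_1$, then $\zeta_{2j}(G)\le 3+|B(G)|$. Otherwise (i.e. if for some bridge $b$ the graph $G-\{b\}$ has a component that is bipartite or isomorphic to $K_1$), there is no finite non-trivial abelian group $\mathbb{A}$ such that $G$ is zero-sum $\mathbb{A}$-magic.
   Context: Graphs are finite and loopless, but may have multiple edges. A bridge is an edge whose deletion results in a graph with exactly one more component than $G$; $B(G)$ is the set of bridges of $G$. For a non-trivial abelian group $\mathbb{A}$ (written additively, identity $0$), a graph $G$ is zero-sum $\mathbb{A}$-magic if there is a function $\phi: E(G)\to \mathbb{A}\setminus\{0\}$ such that for every vertex $v$ the sum of $\phi(e)$ over all edges $e$ incident to $v$ is $0$. $\mathbb{Z}_n$ is the group of integers modulo $n$, and $\mathbb{Z}_n^k$ is the direct product of $k$ copies of it. For $j\ge 1$, $\zeta_{2j}(G)$ is the smallest positive integer $c$ such that $G$ is zero-sum $\mathbb{Z}_{2j}^c$-magic if such $c$ exists, and $\infty$ otherwise. *)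

(* Defs.v *)
From HB Require Import structures.
From mathcomp Require Import all_boot all_order all_algebra.
From mathcomp Require Import boolp.
Set Implicit Arguments.
Unset Strict Implicit.
Unset Printing Implicit Defensive.
Import GRing.Theory.

(* Finite loopless multigraphs: the edges form a type of their own, and each
   edge has a set of exactly two end vertices. *)
Record mgraph := MGraph {
  vertex :> finType;
  edge : finType;
  ends : edge -> {set vertex};
  card_ends : forall e, #|ends e| = 2
}.

Definition adj (G : mgraph) : rel G :=
  [rel x y | [exists e : edge G, ends e == [set x; y]]].

Definition ncomponents (G : mgraph) : nat := n_comp (@adj G) predT.

Definition connected (G : mgraph) : Prop := ncomponents G = 1.

Definition del_edges (G : mgraph) (S : {set edge G}) : mgraph :=
  @MGraph G {e : edge G | e \notin S}
    (fun e => ends (val e)) (fun e => card_ends (val e)).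

Definition bridges (G : mgraph) : {set edge G} :=
  [set b | ncomponents (del_edges [set b]) == (ncomponents G).+1].

Section InducedSubgraph.
Variables (G : mgraph) (S : {set G}).

Definition induced_ends (e : {e : edge G | ends e \subset S}) :
  {set {x : G | x \in S}} := [set x | val x \in ends (val e)].

Lemma card_induced_ends e : #|induced_ends e| = 2.
Proof.
rewrite -(card_ends (val e)) -(card_imset _ val_inj); apply: eq_card => x.
apply/imsetP/idP => [[y] | xe]; first by rewrite inE => ye ->.
by exists (Sub x (subsetP (valP e) x xe)); rewrite ?inE SubK.
Qed.

Definition induced : mgraph := MGraph card_induced_ends.
End InducedSubgraph.

(* The connected component containing x; every component has this form. *)
Definition component (G : mgraph) (x : G) : mgraph :=
  induced [set y | connect (@adj G) x y].

(* A part of the bipartition may be empty, so K_1 is bipartite here. *)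
Definition bipartite (G : mgraph) : Prop :=
  exists X : {set G}, forall e : edge G,
    #|ends e :&: X| = 1 /\ #|ends e :&: ~: X| = 1.

Definition isomorphic (G H : mgraph) : Prop :=
  exists (f : G -> H) (g : edge G -> edge H),
    [/\ bijective f, bijective g & forall e, ends (g e) = f @: ends e].

Definition K1_ends (e : void) : {set unit} := match e with end.

Definition K1 : mgraph :=
  @MGraph unit void K1_ends (fun e : void => match e with end).

Definition zero_sum_magic (A : zmodType) (G : mgraph) : Prop :=
  exists phi : edge G -> A,
    (forall e, phi e != 0%R) /\
    (forall v : G, (\sum_(e | v \in ends e) phi e)%R = 0%R).

(* zeta j G is the invariant with index 2j, with None standing for infinity;
   it is meant for 1 <= j, since 'Z_0 is the ring of integers modulo 2. *)
Definition zeta (j : nat) (G : mgraph) : option nat :=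
  let P c := `[< 0 < c /\ zero_sum_magic 'rV['Z_(2 * j)]_c G >] in
  if pselect (exists c, P c) is left exP then Some (ex_minn exP) else None.

Definition le_nat_infty (x : option nat) (m : nat) : bool :=
  if x is Some c then c <= m else false.

(* Main.v *)
(* A non-bridge edge lies on a cycle, so Jaeger's 8-flow theorem gives an
   F_2^3-flow that is nonzero on all non-bridge edges; multiplied by j it is a
   zero-sum labelling by elements of order 2 of Z_2j^3.  Each bridge b gets one
   further coordinate: from each end x of b walk along a closed walk of odd
   length with alternating signs (it exists as the component of x in G - b is
   not bipartite); this labelling has vertex sums 2 at x and 0 elsewhere, and
   subtracting the two of them from the label 2 on b leaves sums 0.
   Conversely, if G - b has a bipartite component, the alternating sum of the
   vertex sums over this component is the label of b up to sign.

   The 8-flow theorem is proved by Seymour's closure argument.  Contracting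
   edges, one may assume that there are no cuts of one or two edges.  Then there
   is an F_2-flow h from whose support all edges are reached by repeatedly adding
   cycles with at most two new edges; treating these cycles in reverse order, one
   finds an F_2^2-flow which is nonzero outside the support of h. *)
Require Import Defs.
From mathcomp Require Import all_boot all_order all_algebra.
From mathcomp Require Import boolp zify.
Set Implicit Arguments.
Unset Strict Implicit.
Unset Printing Implicit Defensive.
Import Order.TTheory GRing.Theory Num.Theory.

(** * Flows and cuts *)

Section Flows.
Local Open Scope ring_scope.
Variables V E : finType.

Section Divergence.
Variables s t : E -> V.

(** Loops are allowed, because contraction creates them; a loop contributes 0. *)
Definition div (A : zmodType) (phi : E -> A) (v : V) : A :=
  \sum_e (phi e *+ (s e == v) - phi e *+ (t e == v)).

Definition flow (A : zmodType) (phi : E -> A) := forall v, div phi v = 0.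

Lemma divD (A : zmodType) (phi psi : E -> A) v :
  div (fun e => phi e + psi e) v = div phi v + div psi v.
Proof.
by rewrite /div -big_split; apply: eq_bigr => e _ /=; rewrite !mulrnDl opprD addrACA.
Qed.

Lemma divN (A : zmodType) (phi : E -> A) v :
  div (fun e => - phi e) v = - div phi v.
Proof.
by rewrite /div -sumrN; apply: eq_bigr => e _ /=; rewrite !mulNrn opprB opprK addrC.
Qed.

Lemma div0 (A : zmodType) v : div (fun _ => 0 : A) v = 0.
Proof. by rewrite /div big1 // => e _; rewrite !mul0rn subrr. Qed.

Lemma div_raddf (A B : zmodType) (f : {additive A -> B}) (phi : E -> A) v :
  div (fun e => f (phi e)) v = f (div phi v).
Proof.
by rewrite /div raddf_sum; apply: eq_bigr => e _; rewrite raddfB !raddfMn.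
Qed.

Lemma div_single (A : zmodType) (c : A) g v :
  div (fun e => c *+ (e == g)) v = c *+ (s g == v) - c *+ (t g == v).
Proof.
rewrite /div (bigD1 g) //= eqxx mulr1n big1 ?addr0 // => e /negPf->.
by rewrite !mulr0n !mul0rn subrr.
Qed.

Lemma sum_div (A : zmodType) (phi : E -> A) (M : pred V) :
  \sum_(v | M v) div phi v = \sum_e (phi e *+ M (s e) - phi e *+ M (t e)).
Proof.
have aux (w : V) (a : A) : \sum_(v | M v) a *+ (w == v) = a *+ M w.
  rewrite big_mkcond (bigD1 w) //= eqxx big1 ?addr0; first by case: (M w).
  by move=> v nvw; rewrite eq_sym (negPf nvw); case: ifP.
rewrite exchange_big; apply: eq_bigr => e _.
by rewrite sumrB !aux.
Qed.

Definition ins (U : {set V}) : {set E} := [set e | (s e \in U) && (t e \in U)].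

Definition cut (X : {set E}) (M : {set V}) : {set E} :=
  [set e in X | (s e \in M) != (t e \in M)].

Definition link (X : {set E}) : rel V := fun u v =>
  [exists e in X, ((s e == u) && (t e == v)) || ((t e == u) && (s e == v))].

Lemma link_sym X : symmetric (link X).
Proof.
move=> u v; apply: eq_existsb => e.
by congr (_ && _); rewrite orbC andbC [(s e == u) && _]andbC.
Qed.

Lemma connect_link_sym X : connect_sym (link X).
Proof. exact/sym_connect_sym/link_sym. Qed.

Lemma connect_linkS (X Y : {set E}) u v :
  X \subset Y -> connect (link X) u v -> connect (link Y) u v.
Proof.
move=> /subsetP XY; apply: connect_sub => {u v} u v /existsP[e /andP[eX uv]].
by apply/connect1/existsP; exists e; rewrite (XY _ eX).
Qed.

Lemma connect_link_edge (X : {set E}) e : e \in X -> connect (link X) (s e) (t e).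
Proof. by move=> eX; apply/connect1/existsP; exists e; rewrite eX !eqxx. Qed.

Lemma component_closed (X : {set E}) x e : e \in X ->
  connect (link X) x (s e) = connect (link X) x (t e).
Proof.
move=> eX; have c := connect_link_edge eX.
apply/idP/idP => h; first exact: connect_trans h c.
by apply: connect_trans h _; rewrite connect_link_sym.
Qed.

(** * Augmenting paths for unit capacities *)

Section Augmentation.
Variables (X : {set E}) (f : E -> int).
Hypothesis f_bound : forall e, -1 <= f e <= 1.

(** The residual graph of [f] when each edge of [X] has capacity 1 in both directions. *)
Definition residual : rel V := fun u v =>
  [exists e in X, [&& s e == u, t e == v & f e < 1]
               || [&& t e == u, s e == v & -1 < f e]].

(** [f] changes by one unit along the path. As the vertices of the path are distinct, no edge is
    changed twice, so the bounds survive. *)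
Lemma augment_path x p : path residual x p -> uniq (x :: p) ->
  exists q : E -> int,
    [/\ forall e, q e != 0 ->
          [/\ e \in X, s e \in x :: p & t e \in x :: p],
        forall e, -1 <= f e + q e <= 1
      & forall v, div q v = (x == v)%:R - (last x p == v)%:R].
Proof.
elim: p x => [|y p IHp] x /=.
  move=> _ _; exists (fun _ => 0); split=> [e|e|v]; first by rewrite eqxx.
    by rewrite addr0.
  by rewrite div0 subrr.
case/andP=> /existsP[g /andP[gX gxy]] pp /andP[xNp up].
have [q [qs qb qd]] := IHp y pp up.
have qg0 : q g = 0.
  apply/eqP; apply: contraNT xNp => /qs[_ sg tg].
  by case/orP: gxy => /and3P[/eqP<-].
pose c : int := if (s g == x) && (t g == y) && (f g < 1) then 1 else -1.
exists (fun e => q e + c *+ (e == g)); split.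
- move=> e; case: (eqVneq e g) => [-> _|_].
    by split=> //; case/orP: gxy => /and3P[/eqP sg /eqP tg _];
      rewrite ?sg ?tg !in_cons eqxx ?orbT.
  by rewrite addr0 => /qs[eX se te]; split=> //; rewrite in_cons ?se ?te orbT.
- move=> e; case: (eqVneq e g) => [->|_]; last by rewrite addr0.
  rewrite qg0 add0r mulr1n /c; have := f_bound g.
  case: ifP => [/andP[_]|]; first lia.
  case/orP: gxy => /and3P[/eqP -> /eqP-> h]; rewrite ?h ?eqxx //; last lia.
- move=> v; rewrite divD qd div_single /c.
  case: ifP => [/andP[/andP[/eqP sg /eqP tg] _]|]; first rewrite sg tg.
    by rewrite addrC addrA subrK.
  case/orP: gxy => /and3P[/eqP sg /eqP tg h]; rewrite sg tg ?h ?eqxx // => _.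
  by rewrite !mulNrn opprK [LHS]addrC [- _ + _]addrC addrA subrK.
Qed.

(** The augmentation step of Ford and Fulkerson. If [y] cannot be reached in the residual graph, all
    edges leaving the reached set [M] are saturated outwards, so this cut has only [c] edges. *)
Lemma augment x y (c : nat) :
    (forall e, e \notin X -> f e = 0) ->
    (forall v, div f v = c%:R * ((x == v)%:R - (y == v)%:R)) ->
    (forall M : {set V}, x \in M -> y \notin M -> (c < #|cut X M|)%N) ->
  exists q : E -> int,
    [/\ forall e, e \notin X -> q e = 0,
        forall e, -1 <= q e <= 1
      & forall v, div q v = c.+1%:R * ((x == v)%:R - (y == v)%:R)].
Proof.
move=> fX df cutM.
have [/connectP[p0 pp0 yE]|nxy] := boolP (connect residual x y).
  rewrite {cutM}yE in df *; case/shortenP: pp0 df => p pp up _ df.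
  have [q [qs qb qd]] := augment_path pp up.
  exists (fun e => f e + q e); split=> // [e eX|v].
    by rewrite fX // add0r; apply/eqP; apply: contraNT eX => /qs[].
  by rewrite divD df qd -[in RHS]natr1 mulrDl mul1r.
pose M := [set z | connect residual x z].
have xM : x \in M by rewrite inE connect0.
have yM : y \notin M by rewrite inE.
have step e u v : e \in X -> u \in M -> v \notin M ->
    [&& s e == u, t e == v & f e < 1] || [&& t e == u, s e == v & -1 < f e] = false.
  rewrite !inE => eX xu; apply: contraNF => h; apply: connect_trans xu _.
  by apply/connect1/existsP; exists e; rewrite eX.
(* Summation over the vertices gives [c]; summation over the edges gives the size of the cut. *)
have : \sum_(v in M) div f v = c%:R.
  rewrite (eq_bigr _ (fun v _ => df v)) -mulr_sumr sumrB.
  rewrite (bigD1 x) //= eqxx big1 => [|v /andP[_ vx]]; last first.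
    by rewrite eq_sym (negPf vx).
  rewrite big1 ?subr0 ?addr0 ?mulr1 // => v vM; case: eqP => // yv.
  by rewrite yv vM in yM.
rewrite sum_div.
have -> : \sum_e (f e *+ (s e \in M) - f e *+ (t e \in M)) = #|cut X M|%:R.
  rewrite -sum1_card natr_sum [in RHS]big_mkcond; apply: eq_bigr => e _.
  rewrite [e \in cut _ _]inE; case: (boolP (e \in X)) => eX /=; last first.
    by rewrite fX // !mul0rn subrr.
  have := f_bound e; have := step e (s e) (t e) eX; have := step e (t e) (s e) eX.
  rewrite !eqxx /=.
  case: (s e \in M); case: (t e \in M) => //= h1 h2; rewrite ?mulr1n ?mulr0n.
  - by rewrite subrr.
  - move: (h2 isT isT) => {h1 h2}; case: (f e < 1) / idP => //; lia.
  - move: (h1 isT isT) => {h1 h2}; rewrite orbC; case: (-1 < f e) / idP => //; lia.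
by move/eqP; rewrite eqr_nat => /eqP eqc; have := cutM M xM yM; rewrite eqc ltnn.
Qed.
End Augmentation.

(* Menger's theorem for two edge-disjoint paths, as an integer flow of value 2. *)
Lemma two_flow X x y :
    (x != y -> forall M : {set V}, x \in M -> y \notin M -> (1 < #|cut X M|)%N) ->
  exists f : E -> int,
    [/\ forall e, e \notin X -> f e = 0,
        forall e, -1 <= f e <= 1
      & forall v, div f v = 2%:R * ((x == v)%:R - (y == v)%:R)].
Proof.
have [<- _|nxy /(_ isT) cutM] := eqVneq x y.
  by exists (fun _ => 0); split=> // v; rewrite div0 subrr mulr0.
have [|//|v|M xM yM|f1 [f1X f1b f1d]] := @augment X (fun _ => 0) _ x y 0.
- by [].
- by rewrite div0 mul0r.
- by apply: leq_trans (cutM M xM yM).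
exact: (augment f1b f1X f1d cutM).
Qed.

(** The edges of a walk are added up; no bound on the values has to be kept, so edges may repeat. *)
Lemma connect_div (X : {set E}) x y : connect (link X) x y ->
  exists q : E -> 'F_2, (forall e, e \notin X -> q e = 0) /\
    (forall v, div q v = (x == v)%:R - (y == v)%:R).
Proof.
case/connectP=> p pp ->; elim: p x pp => [|z p IHp] x /=.
  by move=> _; exists (fun _ => 0); split=> // v; rewrite div0 subrr.
case/andP=> /existsP[g /andP[gX gxz]] /IHp[q [qX qd]].
pose c : 'F_2 := if (s g == x) && (t g == z) then 1 else -1.
exists (fun e => q e + c *+ (e == g)); split=> [e eX|v].
  by rewrite qX // add0r; case: eqP => // eg; rewrite -eg (negPf eX) in gX.
rewrite divD qd div_single /c.
case: ifP => [/andP[/eqP sg /eqP tg]|]; first rewrite sg tg.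
  by rewrite addrC addrA subrK.
case/orP: gxz => /andP[/eqP sg /eqP tg]; rewrite sg tg ?eqxx // => _.
by rewrite !mulNrn opprK [LHS]addrC [- _ + _]addrC addrA subrK.
Qed.

End Divergence.
End Flows.

(** * Seymour's closure *)

Section Growth.
Local Open Scope ring_scope.

Lemma F2_neq0 (x : 'F_2) : x != 0 -> x = 1.
Proof. by case: x => [[|[|//]] lt] // _; apply: val_inj. Qed.

Lemma F2_addxx (x : 'F_2) : x + x = 0.
Proof. by case: x => [[|[|//]] lt]; apply: val_inj. Qed.

(** Four vectors, at most two of them forbidden: this is why a cycle may bring in two new edges. *)
Lemma avoid2 (p q : 'rV['F_2]_2) : exists a, a != p /\ a != q.
Proof.
have /set0Pn[a] : ~: [set p; q] != set0.
  rewrite -card_gt0; have := cardsC [set p; q]; rewrite card_mx card_Fp // cards2.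
  by case: (p != q); lia.
by rewrite !inE negb_or => /andP[? ?]; exists a.
Qed.

Variables (V E : finType) (s t : E -> V).

Local Notation flow := (flow s t).
Local Notation ins := (ins s t).
Local Notation cut := (cut s t).
Local Notation link := (link s t).

Lemma flow_scale (C : E -> 'F_2) (a : 'rV['F_2]_2) :
  flow C -> flow (fun e => C e *: a).
Proof.
move=> fC v; have := congr1 ( *:%R^~ a) (fC v); rewrite /= scale0r => <-.
rewrite /div scaler_suml; apply: eq_bigr => e _.
by rewrite scalerBl !scalerMnl.
Qed.

Lemma flowD (A : zmodType) (phi psi : E -> A) :
  flow phi -> flow psi -> flow (fun e => phi e + psi e).
Proof. by move=> f1 f2 v; rewrite divD f1 f2 addr0. Qed.

(* Seymour's closure: all edges of [X] are reached from [H].  The arbitrary offset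
   [f] stands for the multiples of the cycles that were treated before. *)
Definition completes (H X : {set E}) := forall f : E -> 'rV['F_2]_2,
  exists g : E -> 'rV['F_2]_2,
    [/\ flow g, forall e, e \notin X -> g e = 0
      & forall e, e \in X -> e \notin H -> f e + g e != 0].

(** The multiple [a] of the cycle is fixed first, to make the new edges nonzero. It then joins the
    offset for which [X] is completed, and that completion vanishes outside [X]. The case [e1 = e2]
    is allowed. *)
Lemma completes_add2 H X (C : E -> 'F_2) e1 e2 :
    flow C -> C e1 != 0 -> C e2 != 0 ->
    (forall e, e \notin [set e1; e2] :|: X -> C e = 0) ->
  completes H X -> completes H ([set e1; e2] :|: X).
Proof.
move=> fC /F2_neq0 C1 /F2_neq0 C2 CX cHX f.
have [a [a1 a2]] := avoid2 (- f e1) (- f e2).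
have [g [fg gX gH]] := cHX (fun e => f e + C e *: a).
exists (fun e => g e + C e *: a); split.
- exact/flowD/flow_scale.
- move=> e eX; rewrite CX // scale0r addr0 gX //.
  by apply: contraNN eX; rewrite in_setU => ->; rewrite orbT.
move=> e; have [eX _ eH|eX] := boolP (e \in X).
  by rewrite addrA addrAC gH.
rewrite in_setU (negPf eX) orbF gX // add0r !inE => /orP[] /eqP -> _.
  by rewrite C1 scale1r addrC addr_eq0.
by rewrite C2 scale1r addrC addr_eq0.
Qed.

(** [e] closes a cycle through [X], in which it is the single new edge. *)
Lemma completes_edge H X e : connect (link X) (s e) (t e) ->
  completes H X -> completes H (e |: X).
Proof.
move=> /connect_div[q [qX dq]] cHX.
have [eX|eX] := boolP (e \in X).
  by rewrite (setUidPr _) // sub1set.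
rewrite -[e |: X]setUid setUACA !setUid -[ [set e]]setUid.
apply: (completes_add2 (C := fun g => 1 *+ (g == e) + - q g)) => //.
- by move=> v; rewrite divD divN div_single dq subrr.
- by rewrite eqxx qX.
- by rewrite eqxx qX.
- move=> g; rewrite !inE orbb negb_or => /andP[/negPf-> gX].
  by rewrite qX // subr0.
Qed.

Lemma completes_fill H (X Y : {set E}) : X \subset Y ->
    (forall e, e \in Y -> connect (link X) (s e) (t e)) ->
  completes H X -> completes H Y.
Proof.
move: {2}#|Y :\: X| (leqnn #|Y :\: X|) => n.
elim: n X => [|n IHn] X leYX XY cY cHX.
  suff -> : Y = X by [].
  apply/eqP; rewrite eqEsubset XY andbT -setD_eq0 -cards_eq0.
  by rewrite -leqn0.
have [YX|[e]] := set_0Vmem (Y :\: X).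
  suff -> : Y = X by [].
  by apply/eqP; rewrite eqEsubset XY andbT -setD_eq0 YX.
rewrite inE => /andP[eX eY].
apply: (IHn (e |: X)); last exact: completes_edge (cY e eY) cHX.
- rewrite -ltnS; apply: leq_trans leYX; apply: proper_card.
  apply/properP; split; first by apply: setDS; apply: subsetUr.
  by exists e; rewrite !inE ?eX // eqxx.
- by rewrite subUset sub1set eY.
- by move=> g gY; apply: connect_linkS (cY g gY); apply: subsetUr.
Qed.

(** The edges of [Z] are exempt from being nonzero, so the labelling found for [X] serves
    unchanged. *)
Lemma completes_even (H H' X Z : {set E}) : completes H X -> Z \subset H' ->
    (forall e, e \in X -> e \notin H' -> e \notin H) ->
  completes H' (X :|: Z).
Proof.
move=> cHX ZH' HH' f; have [g [fg gX gH]] := cHX f; exists g; split=> // e.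
  by rewrite in_setU negb_or => /andP[/gX].
rewrite in_setU => /orP[eX eH|eZ]; first by apply: gH => //; apply: HH'.
by rewrite (subsetP ZH' _ eZ).
Qed.

(* [U] need not meet a single component of the graph, hence the premise of the
   connectedness clause. *)
Definition good (U : {set V}) := exists h : E -> 'F_2,
  [/\ flow h, forall e, e \notin ins U -> h e = 0,
      completes [set e | h e != 0] (ins U)
    & {in U &, forall u v, connect (link setT) u v -> connect (link (ins U)) u v}].

Lemma good0 : good set0.
Proof.
exists (fun _ => 0); split=> //; first by move=> v; apply: div0.
  move=> f; exists (fun _ => 0); split=> //; first by move=> v; apply: div0.
  by move=> e; rewrite !inE.
by move=> u; rewrite inE.
Qed.

Lemma connect_closed (U : {set V}) u v : cut setT U = set0 ->
  connect (link setT) u v -> u \in U -> v \in U.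
Proof.
move=> cU uv uU; rewrite -(closed_connect _ uv) // => {u v uv uU} u v.
case/existsP=> e /andP[_ uv]; have := in_set0 e; rewrite -cU !inE /= => /negbFE/eqP.
by case/orP: uv => /andP[/eqP-> /eqP->].
Qed.

Lemma insS (U W : {set V}) : U \subset W -> ins U \subset ins W.
Proof.
move=> /subsetP UW; apply/subsetP=> e; rewrite !inE.
by case/andP=> /UW-> /UW->.
Qed.

(** As no edge leaves [U], the only new edges are loops at [x], whose ends are trivially
    connected. *)
Lemma good_isolated U x : cut setT U = set0 -> x \notin U -> good U -> good (x |: U).
Proof.
move=> cU xU [h [fh hU ch conU]].
have UU : ins U \subset ins (x |: U) by apply/insS/subsetUr.
have no u : u \in U -> connect (link setT) u x = false.
  by move=> uU; apply: contraNF xU => /connect_closed; apply.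
have con : {in x |: U &, forall u v,
    connect (link setT) u v -> connect (link (ins U)) u v}.
  move=> u v; rewrite !inE => /predU1P[->|uU] /predU1P[->|vU] //.
  - by rewrite connect_link_sym no.
  - by rewrite no.
  - exact: conU.
exists h; split=> //.
- by move=> e eU; apply: hU; apply: contraNN eU; apply: (subsetP UU).
- apply: completes_fill UU _ ch => e; rewrite inE => /andP[sU tU].
  by apply: con => //; apply: connect_link_edge; rewrite inE.
- by move=> u v uU vU uv; apply: connect_linkS UU _; apply: con.
Qed.

(* Modulo 2, the two edge-disjoint paths between x and y form an even set of
   edges in which x and y are connected. *)
Lemma even_link (L : {set V}) x y :
    (x != y -> forall M : {set V}, x \in M -> y \notin M ->
       (1 < #|cut (ins L) M|)%N) ->
  exists h : E -> 'F_2,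
    [/\ flow h, forall e, e \notin ins L -> h e = 0
      & connect (link [set e | h e != 0]) x y].
Proof.
move=> /two_flow[f [fL fb df]].
exists (fun e => (f e)%:~R); split.
- move=> v; rewrite (div_raddf s t (intmul (1 : 'F_2))) df /= intrM.
  by rewrite (_ : 2%:~R = 0) ?mul0r //; apply: val_inj.
- by move=> e /fL->.
(* The values of [f] are -1, 0 or 1, so reduction modulo 2 keeps the support. *)
have fH e : ((f e)%:~R : 'F_2) = 0 -> f e = 0.
  by have := fb e; case: (f e) => [[|[|n]]|[|n]] //; lia.
apply/contraT => nxy; set X := [set e | _] in nxy.
(* No edge of the support leaves [K], so the divergences over [K] sum to 0; with [y] outside [K]
   they would sum to 2. *)
pose K := [set z | connect (link X) x z].
have xK : x \in K by rewrite inE.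
have yK : y \in K = false by rewrite inE; apply/negbTE.
have := sum_div s t f (mem K).
rewrite [in RHS]big1 => [|e _]; last first.
  have [/eqP/fH->|eX] := boolP ((f e)%:~R == 0 :> 'F_2).
    by rewrite !mul0rn subrr.
  have eX' : e \in X by rewrite inE.
  by rewrite /= !inE (component_closed s t x eX') subrr.
rewrite (eq_bigr _ (fun v _ => df v)) -mulr_sumr sumrB.
rewrite (bigD1 x) //= eqxx big1 => [|v /andP[_ vx]]; last first.
  by rewrite eq_sym (negPf vx).
rewrite big1 // => v vK; case: eqP => // yv.
by rewrite yv vK in yK.
Qed.

(** The component of [x1] in the support of [h'] is joined to [U]. Its even edges come for free, and
    [e1], [e2] are the two new edges of one cycle through it and [U]. All remaining edges inside the
    enlarged set then have connected ends. *)
Lemma good_attach (U L : {set V}) (h' : E -> 'F_2) u1 u2 x1 x2 e1 e2 :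
    L \subset ~: U -> u1 \in U -> u2 \in U -> x1 \in L -> x2 \in L ->
    e1 != e2 ->
    (forall X : {set E}, e1 \in X -> link X u1 x1) ->
    (forall X : {set E}, e2 \in X -> link X u2 x2) ->
    e1 \notin ins U -> e2 \notin ins U -> e1 \notin ins L -> e2 \notin ins L ->
    flow h' -> (forall e, e \notin ins L -> h' e = 0) ->
    connect (link [set e | h' e != 0]) x1 x2 ->
  good U -> exists2 W : {set V}, U \proper W & good W.
Proof.
move=> LU u1U u2U x1L x2L ne l1 l2 e1U e2U e1L e2L fh' h'L con12 [h [fh hU ch conU]].
have inLU z : z \in L -> z \in U = false.
  by move/(subsetP LU); rewrite inE => /negbTE.
pose K := [set z | connect (link [set e | h' e != 0]) x1 z].
have x1K : x1 \in K by rewrite inE.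
have x2K : x2 \in K by rewrite inE.
have KL : K \subset L.
  apply/subsetP => z; rewrite inE => cz.
  rewrite -(closed_connect _ cz) // => {z cz} u v.
  case/existsP=> e /andP[]; rewrite inE => he uv.
  have : e \in ins L by apply: contraNT he => /h'L->.
  by rewrite inE => /andP[]; case/orP: uv => /andP[/eqP<- /eqP<-] -> ->.
(* Only the part of [h'] on the component [K] is added to [h]: the rest of its
   support is not attached to [U]. *)
pose k e := if s e \in K then h' e else 0.
pose Z := [set e | k e != 0].
have Kst e : h' e != 0 -> (s e \in K) = (t e \in K).
  by move=> he; rewrite !inE (component_closed s t x1) // inE.
have fk : flow k.
  move=> v; rewrite /div; case: (boolP (v \in K)) => vK.
    rewrite -[RHS](fh' v); apply: eq_bigr => e _; rewrite /k.
    have [->|he] := eqVneq (h' e) 0; first by case: ifP.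
    case: (boolP (s e \in K)) => // sK.
    have tK := sK; rewrite Kst // in tK.
    have [sv|_] := eqVneq (s e) v; first by rewrite sv vK in sK.
    have [tv|_] := eqVneq (t e) v; first by rewrite tv vK in tK.
    by [].
  rewrite big1 // => e _; rewrite /k; case: ifP => sK; last by rewrite !mul0rn subrr.
  have [->|he] := eqVneq (h' e) 0; first by rewrite !mul0rn subrr.
  have tK := sK; rewrite Kst // in tK.
  have [sv|_] := eqVneq (s e) v; first by rewrite -sv sK in vK.
  have [tv|_] := eqVneq (t e) v; first by rewrite -tv tK in vK.
  by rewrite subrr.
have kK e : k e != 0 -> e \in ins K.
  rewrite /k; case: ifP => [sK he|]; last by rewrite eqxx.
  by rewrite inE -Kst // sK.
have conK z : z \in K -> connect (link Z) x1 z.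
  rewrite inE => /connectP[p0 pp0 ->].
  suff gen p x : path (link [set e | h' e != 0]) x p -> x \in K ->
    connect (link Z) x (last x p) by apply: gen.
  elim: p x => [|y p IHp] x //= /andP[xy pp] xK.
  have xyZ : link Z x y.
    case/existsP: xy => e /andP[]; rewrite inE => he exy.
    apply/existsP; exists e; rewrite exy andbT inE /k.
    have := Kst e he; case/orP: exy => /andP[/eqP-> /eqP->]; first by rewrite xK.
    by rewrite xK => ->.
  apply: connect_trans (connect1 xyZ) (IHp y pp _).
  rewrite inE; rewrite inE in xK; apply: connect_trans xK (connect1 _).
  exact: xy.
clearbody K.
pose W := U :|: K; exists W.
  apply/properP; split; first exact: subsetUl.
  by exists x1; rewrite ?in_setU ?x1K ?orbT ?inLU.
pose X0 := ins U :|: Z; pose X1 := [set e1; e2] :|: X0.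
have X0X1 : X0 \subset X1 by apply: subsetUr.
have ZX1 : Z \subset X1 by apply: subset_trans X0X1; apply: subsetUr.
have UX1 : ins U \subset X1 by apply: subset_trans X0X1; apply: subsetUl.
have X1W : X1 \subset ins W.
  have UW : U \subset W by apply: subsetUl.
  have KW : K \subset W by apply: subsetUr.
  rewrite !subUset (insS UW) !sub1set.
  have eW u x e : u \in U -> x \in K -> (forall X : {set E}, e \in X -> link X u x) -> e \in ins W.
    move=> uU xK /(_ [set e] (set11 _))/existsP[g]; rewrite inE => /andP[/eqP->] gux.
    by rewrite !inE; case/orP: gux => /andP[/eqP-> /eqP->]; rewrite uU xK orbT.
  rewrite (eW u1 x1) // (eW u2 x2) //=.
  apply/subsetP => e; rewrite inE => /kK; exact/subsetP/insS.
have e1X : e1 \in X1 by rewrite !inE eqxx.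
have e2X : e2 \in X1 by rewrite !inE eqxx orbT.
have xX : connect (link X1) x1 x2 by apply: connect_linkS ZX1 (conK _ _).
have toT X u v : connect (link X) u v -> connect (link setT) u v.
  by apply: connect_linkS; apply: subsetT.
have toU w : w \in W -> exists2 u, u \in U & connect (link X1) w u.
  rewrite inE => /orP[wU|wK]; first by exists w.
  exists u1 => //; apply: (@connect_trans _ _ x1).
    by rewrite connect_link_sym; apply: connect_linkS ZX1 (conK _ _).
  by rewrite connect_link_sym; apply: connect1; apply: l1.
(* Each vertex of [K] reaches [u1] through [Z] and [e1], so connectedness in [W] reduces to that in
   [U]. *)
have conW : {in W &, forall u v, connect (link setT) u v -> connect (link X1) u v}.
  move=> u v uW vW uv.
  have [u' u'U uu'] := toU u uW; have [v' v'U vv'] := toU v vW.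
  apply: (connect_trans uu'); rewrite connect_link_sym; apply: (connect_trans vv').
  apply: connect_linkS UX1 _; apply: conU => //.
  rewrite connect_link_sym; rewrite connect_link_sym in uu'.
  apply: connect_trans (toT _ _ _ uu') (connect_trans uv (toT _ _ _ vv')).
have nUL e : e \in ins U -> e \in ins L -> False.
  by rewrite !inE => /andP[sU _] /andP[/inLU]; rewrite sU.
have k0 e : e \notin ins L -> k e = 0.
  move=> eL; rewrite /k h'L //; by case: ifP.
(* [h] and [k] have disjoint supports, so nothing cancels in their sum. *)
have cX0 : completes [set e | h e + k e != 0] X0.
  apply: completes_even ch _ _.
    apply/subsetP => e; rewrite !inE => ke; rewrite hU ?add0r //.
    apply/negP => /nUL; apply; exact: (subsetP (insS KL) _ (kK _ ke)).
  move=> e eU; rewrite !inE k0 ?addr0 //; exact/negP/nUL.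
(* [q1] runs from [x1] to [x2] within [Z], and [q2] from [u1] to [u2] within [ins U]. With [e1] and
   [e2] they close up to a cycle whose only edges outside [X0] are [e1] and [e2]. *)
have [q1 [q1X dq1]] := connect_div (conK _ x2K).
have u12 : connect (link setT) u1 u2.
  apply: (@connect_trans _ _ x1); first exact/(toT X1)/connect1/l1.
  apply: connect_trans (toT _ _ _ xX) _.
  by rewrite connect_link_sym; apply/(toT X1)/connect1/l2.
have [q2 [q2X dq2]] := connect_div (conU u1 u2 u1U u2U u12).
have eZ e : e \notin ins L -> q1 e = 0.
  by move=> eL; rewrite q1X // inE k0 // eqxx.
(* Modulo 2 the orientation of [g] does not matter. *)
have del v (g : E) u x : (forall X : {set E}, g \in X -> link X u x) ->
    div s t (fun e => (1 : 'F_2) *+ (e == g)) v = (u == v)%:R - (x == v)%:R.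
  move=> /(_ [set g] (set11 _))/existsP[g']; rewrite inE => /andP[/eqP-> gux].
  rewrite div_single; case/orP: gux => /andP[/eqP-> /eqP->] //.
  rewrite -[LHS]opprK opprB.
  by apply/eqP; rewrite eq_sym -subr_eq0 opprK F2_addxx.
have cX1 : completes [set e | h e + k e != 0] X1.
  apply: (completes_add2 (C := fun e => (1 *+ (e == e1) + q1 e) + - (1 *+ (e == e2) + q2 e))) cX0.
  - move=> v; rewrite divD divN !divD (del v e1 u1 x1) // (del v e2 u2 x2) // dq1 dq2.
    rewrite addrA subrK -[RHS](subrr ((u1 == v)%:R - (x2 == v)%:R)).
    by congr (_ - _); rewrite addrC addrA subrK.
  - by rewrite eqxx eZ // q2X // (negPf ne).
  - by rewrite eqxx eZ // q2X // (eq_sym e2) (negPf ne).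
  - move=> e; rewrite 3!in_setU !in_set1 !negb_or.
    case/andP=> /andP[/negPf-> /negPf->] /andP[eU eZ'].
    by rewrite q1X // q2X // addr0 subrr.
exists (fun e => h e + k e); split.
- exact: flowD.
- move=> e eW; have eX1 : e \notin X1 by apply: contraNN eW; apply: (subsetP X1W).
  rewrite hU; last by apply: contraNN eX1; apply: (subsetP UX1).
  rewrite add0r; apply/eqP; apply: contraNT eX1 => ke.
  by apply: (subsetP ZX1); rewrite inE.
- apply: completes_fill X1W _ cX1 => e; rewrite inE => /andP[sW tW].
  by apply: conW => //; apply: connect_link_edge; rewrite inE.
- by move=> u v uW vW uv; apply: connect_linkS X1W (conW u v uW vW uv).
Qed.

Hypothesis no_small_cut : forall M : {set V},
  cut setT M = set0 \/ (2 < #|cut setT M|)%N.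

(** If edges leave [U], a piece [L] of the complement is chosen with at most one edge to the rest of
    the complement. Its cut has at least three edges, so two of them go to [U]. By minimality no
    single edge of [L] separates their ends [x1] and [x2], so an even set within [L] connects
    these. *)
Lemma good_grow (U : {set V}) : U != setT -> good U -> exists2 W : {set V}, U \proper W & good W.
Proof.
move=> UT gU.
have [cU|cU] := eqVneq (cut setT U) set0.
  have /set0Pn[x] : ~: U != set0.
    by apply: contraNneq UT => UC; rewrite -[U]setCK UC setC0.
  rewrite inE => xU; exists (x |: U); last exact: good_isolated.
  by rewrite properUr // sub1set.
(* A minimal such [L] is a leaf of the bridge tree of a component of [~: U]. *)
pose P (L : {set V}) :=
  [&& L \subset ~: U, (#|cut (ins (~: U)) L| <= 1)%N & cut setT L != set0].
have PU : P (~: U).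
  apply/and3P; split=> //.
    rewrite (_ : cut _ _ = set0) ?cards0 //; apply/setP => e; rewrite !inE.
    by case: (s e \in U); case: (t e \in U).
  apply: contraNneq cU => cU; apply/eqP/setP => e; have /setP/(_ e) := cU.
  by rewrite !inE; case: (s e \in U); case: (t e \in U).
have [L /minsetP[/and3P[LU cL1 cL0] Lmin] _] := minset_exists PU.
have inLU z : z \in L -> z \in U = false.
  by move/(subsetP LU); rewrite inE => /negbTE.
have cL3 : (1 < #|cut setT L :\: cut (ins (~: U)) L|)%N.
  case: (no_small_cut L) => [/eqP|c3]; first by rewrite (negPf cL0).
  rewrite cardsD; have := subset_leq_card (subsetIr (cut setT L) (cut (ins (~: U)) L)).
  by move: c3 cL1; lia.
have ends_of e : e \in cut setT L :\: cut (ins (~: U)) L -> exists u x,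
    [/\ u \in U, x \in L,
        (s e == u) && (t e == x) || (t e == u) && (s e == x),
        e \notin ins U & e \notin ins L].
  rewrite !inE; move: (inLU (s e)) (inLU (t e)).
  case sL: (s e \in L); case tL: (t e \in L) => //=; rewrite ?andbT ?andbF //.
    move=> /(_ isT)-> _ /=; rewrite ?andbT => /negbNE tU.
    by exists (t e), (s e); rewrite !eqxx orbT.
  move=> _ /(_ isT)-> /=; rewrite ?andbT => /negbNE sU.
  by exists (s e), (t e); rewrite !eqxx andbF.
have [e1 [e2 [e1c e2c ne]]] := card_gt1P cL3.
have [u1 [x1 [u1U x1L l1 e1U e1L]]] := ends_of e1 e1c.
have [u2 [x2 [u2U x2L l2 e2U e2L]]] := ends_of e2 e2c.
have [|h' [fh' h'L con]] := @even_link L x1 x2; last first.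
  apply: (good_attach LU u1U u2U x1L x2L ne _ _ e1U e2U e1L e2L fh' h'L con gU).
    by move=> X e1X; apply/existsP; exists e1; rewrite e1X.
  by move=> X e2X; apply/existsP; exists e2; rewrite e2X.
move=> nx M x1M x2M; rewrite ltnNge; apply/negP => cM.
have in_cut g u x (N : {set V}) : u \in U -> x \in N -> N \subset L ->
    (s g == u) && (t g == x) || (t g == u) && (s g == x) -> cut setT N != set0.
  move=> uU xN /subsetP NL gux; apply/set0Pn; exists g; rewrite !inE /=.
  have uN : u \in N = false by apply/negbTE; apply: contraTN uU => /NL/inLU->.
  by case/orP: gux => /andP[/eqP-> /eqP->]; rewrite uN xN.
(* [M] splits [L] by at most one edge, and at most one edge joins [L] to the rest
   of [~: U]; hence the part of [L] not meeting the latter contradicts [Lmin]. *)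
have absurd (N : {set V}) z : N \subset L -> z \in L -> z \notin N -> cut setT N != set0 ->
    cut (ins (~: U)) N \subset cut (ins L) M -> False.
  move=> NL zL zN cN /subset_leq_card /leq_trans/(_ cM) cN1.
  have /Lmin/(_ NL) NE : P N by rewrite /P (subset_trans NL LU) cN1 cN.
  by rewrite NE zL in zN.
have [/existsP[g0 /andP[g0c g0M]]|/existsPn noM] := boolP [exists g in cut (ins (~: U)) L,
    (s g \in L :&: M) || (t g \in L :&: M)].
  apply: (absurd (L :\: M) x1); rewrite ?subsetDl //.
  - by rewrite inE x1M.
  - by apply: (in_cut e2 u2 x2); rewrite ?subsetDl // inE x2M.
  apply/subsetP => g gN.
  have [gc|gc] := boolP (g \in cut (ins (~: U)) L).
    have gE : g = g0.
      by apply/eqP; apply: contraTT cL1 => ng; rewrite -ltnNge; apply/card_gt1P; exists g, g0.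
    move: gN g0c g0M; rewrite gE !inE.
    case: (s g0 \in L); case: (t g0 \in L); case: (s g0 \in M); case: (t g0 \in M);
      by rewrite ?andbF ?andbT.
  move: gN gc; rewrite !inE.
  case: (s g \in L); case: (t g \in L); case: (s g \in M); case: (t g \in M);
    by rewrite /= ?andbF ?andbT // => ->.
apply: (absurd (L :&: M) x2); rewrite ?subsetIl //.
- by rewrite inE (negPf x2M) andbF.
- by apply: (in_cut e1 u1 x1); rewrite ?subsetIl // inE x1L.
apply/subsetP => g gN.
have := noM g; move: gN; rewrite !inE.
case: (s g \in L); case: (t g \in L); case: (s g \in M); case: (t g \in M);
  by rewrite /= ?andbF ?andbT // => ->.
Qed.

(** [good_grow] is iterated from the empty set; the offset 0 then yields [phi]. *)
Lemma four_flow_off_even : exists (h : E -> 'F_2) (phi : E -> 'rV['F_2]_2),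
  [/\ flow h, flow phi & forall e, h e = 0 -> phi e != 0].
Proof.
suff [h [fh _ ch _]] : good setT.
  have [phi [fphi _ H]] := ch (fun _ => 0).
  exists h, phi; split=> // e he; have := H e; rewrite add0r; apply.
    by rewrite !inE.
  by rewrite inE he eqxx.
suff gen n U : good U -> (#|~: U| <= n)%N -> good setT.
  exact: gen good0 (leqnn _).
elim: n U => [|n IHn] U gU cU.
  have UT : ~: U = set0 by apply/eqP; rewrite -cards_eq0 -leqn0.
  by rewrite -setC0 -UT setCK.
have [<- //|UT] := eqVneq U setT.
have [W UW gW] := good_grow UT gU; apply: (IHn W gW).
rewrite -ltnS; apply: leq_trans cU; apply: proper_card.
by rewrite properE !setCS -properE.
Qed.

End Growth.

(** * The 8-flow theorem *)

Section EightFlow.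
Local Open Scope ring_scope.
Variables V E : finType.

(** Equivalently, [e] lies on a cycle, a loop being a cycle. *)
Definition coverable (s t : E -> V) e :=
  exists h : E -> 'F_2, flow s t h /\ h e != 0.

(** Edges inside [M] cancel in the sum of the divergences over [M], and modulo 2 the signs on the
    cut disappear. *)
Lemma sum_cut s t (h : E -> 'F_2) (M : {set V}) : flow s t h ->
  \sum_(e in cut s t setT M) h e = 0.
Proof.
move=> fh; have := sum_div s t h (mem M); rewrite big1 // => h0.
rewrite [RHS]h0 [LHS]big_mkcond; apply: eq_bigr => e _; rewrite !inE /=.
case: (s e \in M); case: (t e \in M) => /=; rewrite ?mulr1n ?mulr0n ?subrr ?subr0 ?sub0r //.
by apply/eqP; rewrite -addr_eq0 F2_addxx.
Qed.

(** * Contraction of an edge *)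

Section Contraction.
Variables (s t : E -> V) (e : E).
Hypothesis nloop : s e != t e.

(** Contraction keeps both types: [t e] becomes an isolated vertex and [e] a loop. *)
Definition merge v := if v == t e then s e else v.

Lemma div_merge (A : zmodType) (phi : E -> A) v :
  div (merge \o s) (merge \o t) phi v = \sum_(w | merge w == v) div s t phi w.
Proof. by rewrite sum_div. Qed.

Lemma coverable_merge f :
  coverable s t f -> coverable (merge \o s) (merge \o t) f.
Proof.
case=> h [fh hf]; exists h; split=> // v.
by rewrite div_merge big1.
Qed.

(** Away from the ends of [e] conservation already holds. At the two ends the divergences are
    opposite, and one change of the label of [e] cancels both. *)
Lemma flow_unmerge (A : zmodType) (phi : E -> A) :
    flow (merge \o s) (merge \o t) phi ->
  exists2 psi, flow s t psi & forall f, f != e -> psi f = phi f.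
Proof.
move=> fphi; pose c := div s t phi (s e).
exists (fun f => phi f + (- c) *+ (f == e)) => [v|f /negPf->]; last by rewrite addr0.
rewrite divD div_single.
have [<-|sv] := eqVneq (s e) v.
  by rewrite [t e == _]eq_sym (negPf nloop) subr0 subrr.
rewrite mulr0n sub0r; have [tv|tv] := eqVneq (t e) v.
  rewrite mulr1n opprK -[RHS](fphi (s e)) div_merge (bigD1 (s e)) /=; last first.
    by rewrite /merge (negPf nloop).
  rewrite addrC (bigD1 (t e)) /=; last by rewrite /merge eqxx eqxx eq_sym.
  rewrite big1 ?addr0 ?tv // => w /andP[/andP[]].
  by rewrite /merge => + + /negPf wt; rewrite tv wt => ->.
rewrite mulr0n subr0 -[RHS](fphi v) div_merge (bigD1 v) /=; last first.
  by rewrite /merge [v == t e]eq_sym (negPf tv).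
rewrite big1 ?addr0 // => w /andP[].
by rewrite /merge; case: ifP => [_|_ ->]; rewrite ?(negPf sv).
Qed.

Lemma card_merge :
  (#|[set f | (merge \o s) f != (merge \o t) f]| < #|[set f | s f != t f]|)%N.
Proof.
apply: proper_card; apply/properP; split.
  by apply/subsetP => f; rewrite !inE /=; apply: contraNN => /eqP->.
by exists e; rewrite !inE //= /merge eqxx (negPf nloop) eqxx.
Qed.
End Contraction.

Lemma flow_coord (s t : E -> V) n (phi : E -> 'rV['F_2]_n) i :
  flow s t phi -> flow s t (fun e => phi e 0 i).
Proof.
move=> fphi v; have := congr1 (fun a : 'rV__ => a 0 i) (fphi v).
rewrite mxE => <-; rewrite /div summxE; apply: eq_bigr => e _.
by rewrite !mxE !mulmxnE.
Qed.

(** Induction on the number of edges that are not loops. If nothing can be contracted, there are no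
    small cuts, and an F_2-flow and an F_2^2-flow are juxtaposed. *)
Theorem eight_flow (s t : E -> V) : exists phi : E -> 'rV['F_2]_3,
  flow s t phi /\ forall e, coverable s t e -> phi e != 0.
Proof.
move: {2}#|[set f | s f != t f]| (leqnn #|[set f | s f != t f]|) => n.
elim: n s t => [|n IHn] s t le_n.
  exists (fun _ => const_mx 1); split=> [v|e _].
    rewrite /div big1 // => e _.
    have : e \notin [set f | s f != t f].
      by move: le_n; rewrite leqn0 cards_eq0 => /eqP->; rewrite inE.
    by rewrite inE negbK => /eqP->; rewrite subrr.
  by apply/rV0Pn; exists 0; rewrite mxE oner_eq0.
(* Contract an edge that is a bridge, or that lies in a 2-edge cut. *)
have [[e [nloop He]]|no] := pselect (exists e, s e != t e /\
    (coverable s t e -> exists f, [/\ f != e, coverable s t f &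
       forall h : E -> 'F_2, flow s t h -> h f != 0 -> h e != 0])).
  have [|phi' [fphi' cphi']] := IHn (merge s t e \o s) (merge s t e \o t).
    by rewrite -ltnS; apply: leq_trans le_n; apply: card_merge.
  have [phi fphi phiE] := flow_unmerge nloop fphi'.
  have cphi f : f != e -> coverable s t f -> phi f != 0.
    by move=> fe cf; rewrite phiE //; apply/cphi'/coverable_merge.
  exists phi; split=> // f cf; have [fe|/cphi] := eqVneq f e; last exact.
  (* A coordinate of [phi] that is nonzero on [g] is an F_2-flow, and every such flow through [g]
     uses [e]. *)
  rewrite fe in cf *; have [g [ge cg ser]] := He cf.
  have /rV0Pn[i gi] := cphi g ge cg.
  by apply/rV0Pn; exists i; apply: (ser (fun x => phi x 0 i)) gi; apply: flow_coord.
have cov e : coverable s t e.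
  have [se|ne] := eqVneq (s e) (t e).
    exists (fun f => 1 *+ (f == e)); split=> [v|]; last by rewrite eqxx.
    by rewrite div_single se subrr.
  by apply: contrapT => nc; apply: no; exists e; split.
have sep e f : s e != t e -> f != e -> exists h : E -> 'F_2,
    [/\ flow s t h, h f != 0 & h e = 0].
  move=> ne fe; apply: contrapT => nh; apply: no; exists e; split=> // _.
  exists f; split=> // h fh hf; apply/negP => /eqP he; apply: nh.
  by exists h.
(* An even set cannot meet a cut in exactly one edge. This contradicts [cov] for a cut of one edge
   and [sep] for a cut of two. *)
have [M|h [phi [fh fphi hphi]]] := @four_flow_off_even V E s t.
  have [->|/set0Pn[e eM]] := eqVneq (cut s t setT M) set0; first by left.
  right; rewrite ltnNge; apply/negP => c2.
  have ne : s e != t e by move: eM; rewrite !inE /=; apply: contraNneq => ->.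
  have [M1|[f]] := set_0Vmem (cut s t setT M :\ e).
    have [h [fh he]] := cov e; have := sum_cut M fh.
    rewrite (big_setD1 e) //= M1 big_set0 addr0 => h0.
    by rewrite h0 eqxx in he.
  rewrite inE in_set1 => /andP[fe fM].
  have [h [fh hf he]] := sep e f ne fe; have := sum_cut M fh.
  rewrite (big_setD1 e) //= he add0r (big_setD1 f) /=; last by rewrite inE in_set1 fe.
  rewrite (_ : _ :\ f = set0) ?big_set0 ?addr0 => [h0|]; first by rewrite h0 eqxx in hf.
  apply/eqP; rewrite -cards_eq0; move: c2.
  by rewrite (cardsD1 e) eM (cardsD1 f) inE in_set1 fe fM; lia.
exists (fun e => row_mx (h e)%:M (phi e) : 'rV_(1 + 2)); split=> [v|e _].
  apply/rowP => i; rewrite mxE /div summxE.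
  case: (@split_ordP 1 2 i) => k ->.
    rewrite -[RHS](fh v); apply: eq_bigr => e _.
    rewrite mxE [fun_of_matrix (- _) _ _]mxE !mulmxnE.
    by congr (_ *+ _ - _ *+ _); apply: etrans (row_mxEl _ _ _ _) _; rewrite ord1 mxE eqxx.
  rewrite -[RHS](flow_coord k fphi v); apply: eq_bigr => e _.
  rewrite mxE [fun_of_matrix (- _) _ _]mxE !mulmxnE.
  by congr (_ *+ _ - _ *+ _); apply: row_mxEr.
suff : row_mx (h e)%:M (phi e) != 0 :> 'M_(1, 1 + 2) by [].
rewrite row_mx_eq0 negb_and.
have [/hphi->|he] := eqVneq (h e) 0; first by rewrite orbT.
by apply/orP; left; apply/rV0Pn; exists 0; rewrite mxE.
Qed.

End EightFlow.

(** * Zero-sum labellings *)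

Section UndirectedSum.
Local Open Scope ring_scope.
Variables (V E : finType) (s t : E -> V).

Definition vsum (A : zmodType) (phi : E -> A) (v : V) : A :=
  \sum_e (phi e *+ (s e == v) + phi e *+ (t e == v)).

Lemma vsumD (A : zmodType) (phi psi : E -> A) v :
  vsum (fun e => phi e + psi e) v = vsum phi v + vsum psi v.
Proof.
by rewrite /vsum -big_split; apply: eq_bigr => e _ /=; rewrite !mulrnDl addrACA.
Qed.

Lemma vsumN (A : zmodType) (phi : E -> A) v :
  vsum (fun e => - phi e) v = - vsum phi v.
Proof.
by rewrite /vsum -sumrN; apply: eq_bigr => e _ /=; rewrite !mulNrn -opprD.
Qed.

Lemma vsum0 (A : zmodType) v : vsum (fun _ => 0 : A) v = 0.
Proof. by rewrite /vsum big1 // => e _; rewrite !mul0rn addr0. Qed.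

Lemma vsum_single (A : zmodType) (c : A) g v :
  vsum (fun e => c *+ (e == g)) v = c *+ (s g == v) + c *+ (t g == v).
Proof.
rewrite /vsum (bigD1 g) //= eqxx mulr1n big1 ?addr0 // => e /negPf->.
by rewrite !mulr0n !mul0rn addr0.
Qed.

(** Double counting of incidences. With weights 1 and -1 on the two sides of a bipartite component,
    the edges inside it drop out. *)
Lemma weighted_vsum (A : zmodType) (phi : E -> A) (w : V -> int) :
  \sum_v vsum phi v *~ w v = \sum_e phi e *~ (w (s e) + w (t e)).
Proof.
have aux (u : V) (a : A) : \sum_v (a *+ (u == v)) *~ w v = a *~ w u.
  rewrite (bigD1 u) //= eqxx big1 ?addr0 // => v nvu.
  by rewrite eq_sym (negPf nvu) mul0rz.
under eq_bigr do rewrite mulrz_suml.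
rewrite exchange_big; apply: eq_bigr => e _ /=.
by under eq_bigr do rewrite mulrzDl; rewrite big_split /= !aux mulrzDr.
Qed.

(** An even and an odd alternating walk from [x] to the same vertex add up to the required
    labelling: their contributions at the far end cancel. If no vertex has both, the parity of the
    walks is a 2-colouring. *)
Lemma nonbipartite_vsum (R : pzRingType) (X : {set E}) x :
    ~ (exists Y : {set V}, forall e, e \in X -> connect (link s t X) x (s e) ->
         (s e \in Y) != (t e \in Y)) ->
  exists psi : E -> R, (forall e, e \notin X -> psi e = 0) /\
    (forall v, vsum psi v = 2%:R *+ (x == v)).
Proof.
move=> nbip; apply: contrapT => npsi; apply: nbip.
(* [walk z b]: an alternating walk from [x] to [z] of even length if [b], odd
   length otherwise. *)
pose walk z (b : bool) := exists psi : E -> R,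
  (forall e, e \notin X -> psi e = 0) /\
  (forall v, vsum psi v = 1 *+ (x == v) + (-1) ^+ b *+ (z == v)).
have walk_link z w b : link s t X z w -> walk z b -> walk w (~~ b).
  case/existsP=> g /andP[gX gzw] [psi [psiX dpsi]].
  (* The sign on the new edge [g] cancels the sum at [z] and moves it, negated, to [w]. *)
  exists (fun e => psi e - (-1) ^+ b *+ (e == g)); split=> [e eX|v].
    rewrite psiX // sub0r; case: eqP => [eg|]; last by rewrite oppr0.
    by rewrite eg gX in eX.
  rewrite vsumD vsumN vsum_single dpsi.
  have -> : (-1) ^+ b *+ (s g == v) + (-1) ^+ b *+ (t g == v) =
            (-1) ^+ b *+ (z == v) + (-1) ^+ b *+ (w == v) :> R.
    by case/orP: gzw => /andP[/eqP-> /eqP->] //; rewrite addrC.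
  by rewrite opprD addrA addrK signrN mulNrn.
have walk_ex z : connect (link s t X) x z -> exists b, walk z b.
  have w0 : walk x true.
    by exists (fun _ => 0); split=> // v; rewrite vsum0 expr1 mulNrn subrr.
  case/connectP=> p0 pp0 ->.
  suff gen p y b : path (link s t X) y p -> walk y b -> exists c, walk (last y p) c.
    exact: gen pp0 w0.
  elim: p y b => [|w p IHp] y b /=; first by exists b.
  by case/andP=> yw pp wy; apply: (IHp w (~~ b)) => //; apply: walk_link yw wy.
have walk2 z : walk z true -> walk z false -> False.
  move=> [p1 [p1X d1]] [p2 [p2X d2]]; apply: npsi.
  exists (fun e => p1 e + p2 e); split=> [e eX|v].
    by rewrite p1X // p2X // addr0.
  by rewrite vsumD d1 d2 expr1 expr0 mulNrn addrACA addNr addr0 -mulrnDl.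
exists [set z | `[< walk z false >]] => e eX /walk_ex[b wb].
have wt : walk (t e) (~~ b).
  by apply: walk_link wb; apply/existsP; exists e; rewrite eX !eqxx.
rewrite !inE; case: b wb wt => /= wb wt.
  by rewrite [X in _ != X]asboolT // asboolF // => /(walk2 _ wb).
by rewrite asboolT // asboolF // => /(walk2 _ wt).
Qed.

End UndirectedSum.

(** * Bridges, components and bipartite sides *)

Section Graphs.
Local Open Scope ring_scope.

(** An arbitrary orientation is chosen, so that the results on flows apply. *)
Lemma ends_fun (G : mgraph) : exists s t : edge G -> G,
  forall e, s e != t e /\ ends e = [set s e; t e].
Proof.
have /choice[f Hf] (e : edge G) : exists xy : G * G, xy.1 != xy.2 /\ ends e = [set xy.1; xy.2].
  by have /eqP/cards2P[x [y [xy ->]]] := card_ends e; exists (x, y).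
by exists (fun e => (f e).1), (fun e => (f e).2).
Qed.

(** Replaces bipartitions of the subtype graph by vertex sets of [H], so that later arguments can
    stay in the ambient graph. *)
Lemma bipartite_induced (H : mgraph) (s t : edge H -> H) (K : {set H}) :
    (forall e, ends e = [set s e; t e]) ->
  bipartite (induced K) <-> exists X : {set H}, forall e,
    s e \in K -> t e \in K -> (s e \in X) != (t e \in X).
Proof.
move=> Hst; split=> [[X HX]|[X HX]].
  exists [set val x | x in X] => e sK tK.
  have eK : ends e \subset K by rewrite Hst subUset !sub1set sK.
  pose xs : {x | x \in K} := Sub (s e) sK; pose xt : {x | x \in K} := Sub (t e) tK.
  have endsE : induced_ends (Sub e eK : {e | ends e \subset K}) = [set xs; xt].
    by apply/setP => z; rewrite !inE -!val_eqE /= Hst !inE.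
  have [] := HX (Sub e eK : {e | ends e \subset K}).
  rewrite /= endsE (mem_imset _ xs val_inj) (mem_imset _ xt val_inj).
  case xsX: (xs \in X); case xtX: (xt \in X) => // c1 c2.
    suff c0 : [set xs; xt] :&: ~: X = set0 by rewrite c0 cards0 in c2.
    apply/setP => z; rewrite !inE; case: eqP => [->|_]; rewrite ?xsX //.
    by case: eqP => [->|//]; rewrite xtX.
  suff c0 : [set xs; xt] :&: X = set0 by rewrite c0 cards0 in c1.
  apply/setP => z; rewrite !inE; case: eqP => [->|_]; rewrite ?xsX //.
  by case: eqP => [->|//]; rewrite xtX.
exists [set x | val x \in X] => -[e eK]; have := eK.
rewrite Hst subUset !sub1set => /andP[sK tK].
pose xs : {x | x \in K} := Sub (s e) sK; pose xt : {x | x \in K} := Sub (t e) tK.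
have endsE : @ends (induced K) (exist _ e eK) = [set xs; xt].
  by apply/setP => z; rewrite !inE -!val_eqE /= Hst !inE.
have := HX e sK tK; rewrite endsE.
have c1 (Y : {set {x | x \in K}}) : (xs \in Y) != (xt \in Y) -> #|[set xs; xt] :&: Y| = 1%N.
  case xsY: (xs \in Y); case xtY: (xt \in Y) => // _.
    rewrite (_ : _ :&: _ = [set xs]) ?cards1 //; apply/setP => z; rewrite !inE.
    by case: eqP => [->|_] //; case: eqP => [->|].
  rewrite (_ : _ :&: _ = [set xt]) ?cards1 //; apply/setP => z; rewrite !inE.
  by case: (z =P xt) => [->|_]; rewrite ?orbT ?orbF //; case: eqP => [->|].
move=> sX; split; apply: c1; rewrite !inE //.
by apply: contra sX => /eqP/negb_inj->.
Qed.

Lemma K1_bipartite (H : mgraph) : isomorphic H K1 -> bipartite H.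
Proof. by case=> _ [g _]; exists set0 => e; case: (g e). Qed.

Variables (G : mgraph) (s t : edge G -> G).
Hypothesis nloop : forall e, s e != t e.
Hypothesis endsE : forall e, ends e = [set s e; t e].

Lemma ends_link e x y : (ends e == [set x; y]) =
  ((s e == x) && (t e == y) || (t e == x) && (s e == y)).
Proof.
rewrite endsE; apply/eqP/orP => [E|[]/andP[/eqP<- /eqP<-] //]; last first.
  by rewrite setUC.
have := nloop e; have : s e \in [set x; y] by rewrite -E !inE eqxx.
have : t e \in [set x; y] by rewrite -E !inE eqxx orbT.
rewrite !inE => /orP[]/eqP-> /orP[]/eqP->; rewrite ?eqxx //.
  by right.
by left.
Qed.

Lemma adj_link : @adj G =2 link s t setT.
Proof.
by move=> x y; apply: eq_existsb => e; rewrite ends_link inE.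
Qed.

Lemma adj_del (S : {set edge G}) : @adj (del_edges S) =2 link s t (~: S).
Proof.
move=> x y; apply/existsP/existsP => [[e]|[e /andP[eS exy]]].
  rewrite ends_link => exy; exists (val e); rewrite exy inE.
  by rewrite (valP e).
have eS' : e \notin S by rewrite inE in eS.
by exists (Sub e eS' : {e | e \notin S}); rewrite /= ends_link.
Qed.

Lemma connect_adj : connect (@adj G) =2 connect (link s t setT).
Proof. exact: eq_connect adj_link. Qed.

Lemma connect_adj_del (S : {set edge G}) :
  connect (@adj (del_edges S)) =2 connect (link s t (~: S)).
Proof. exact: (@eq_connect G _ _ (@adj_del S)). Qed.

Lemma vsum_ends (A : zmodType) (phi : edge G -> A) v :
  \sum_(e | v \in ends e) phi e = vsum s t phi v.
Proof.
rewrite big_mkcond; apply: eq_bigr => e _; rewrite endsE !inE ![v == _]eq_sym.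
have := nloop e; have [<-|_ _] := eqVneq (s e) v.
  by rewrite eq_sym => /negPf->; rewrite addr0.
by case: eqP => _; rewrite add0r.
Qed.

Hypothesis conG : connected G.

(** If [x] and [y] were not connected, their closure alone would account for two components. *)
Lemma connected_connect x y : connect (link s t setT) x y.
Proof.
have sym : connect_sym (@adj G).
  by move=> u v; rewrite !connect_adj connect_link_sym.
have : n_comp (@adj G) predT = 1%N := conG.
rewrite -connect_adj (n_compC (closure (@adj G) (pred2 x y))).
by rewrite n_comp_closure2 //; case: connect.
Qed.

(** The vertices reached from the ends of [b] without using [b] form a set that is closed under all
    edges, [b] included. *)
Lemma del_connect b x : connect (link s t (~: [set b])) (s b) x \/
  connect (link s t (~: [set b])) (t b) x.
Proof.
apply/orP; pose a := [pred x | connect (link s t (~: [set b])) (s b) x ||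
  connect (link s t (~: [set b])) (t b) x].
suff cl : closed (link s t setT) a.
  rewrite -[_ || _]/(x \in a) -(closed_connect cl (connected_connect (s b) x)).
  by rewrite inE connect0.
apply: intro_closed; first exact: connect_link_sym.
move=> u v /existsP[e /andP[_ uv]]; rewrite !inE.
have [eb|eb] := eqVneq e b.
  by move=> _; case/orP: uv => /andP[_ /eqP<-]; rewrite eb connect0 ?orbT.
have uvb : link s t (~: [set b]) u v.
  by apply/existsP; exists e; rewrite !inE eb.
by case/orP=> uc; rewrite (connect_trans uc (connect1 uvb)) ?orbT.
Qed.

Lemma bridge_disconnects b : b \in bridges G ->
  ~~ connect (link s t (~: [set b])) (s b) (t b).
Proof.
rewrite inE; apply: contraL => con.
suff -> : ncomponents (del_edges [set b]) = ncomponents G by rewrite neq_ltn ltnSn.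
apply: eq_n_comp => x y; rewrite connect_adj_del connect_adj.
rewrite connected_connect.
by case: (del_connect b x) => cx; case: (del_connect b y) => cy;
  rewrite connect_link_sym in cx; apply: (connect_trans cx);
  try exact: connect_trans cy; rewrite // connect_link_sym;
  apply: connect_trans con; rewrite connect_link_sym.
Qed.

(** By [del_connect] the ends of [b] meet every component of the graph without [b]; if they were
    disconnected, there would be exactly two. *)
Lemma nonbridge_connect b : b \notin bridges G ->
  connect (link s t (~: [set b])) (s b) (t b).
Proof.
rewrite inE; apply: contraR => ncon.
rewrite /ncomponents [n_comp (@adj G) _]conG.

have sym : connect_sym (@adj (del_edges [set b])).
  by move=> x y; rewrite !connect_adj_del connect_link_sym.
rewrite (eq_n_comp_r (a' := closure (@adj (del_edges [set b])) (pred2 (s b) (t b)))).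
  by rewrite n_comp_closure2 // connect_adj_del ncon.
move=> x; apply/esym/existsP; case: (del_connect b x) => cx;
  [exists (s b) | exists (t b)];
  by rewrite !inE eqxx ?orbT andbT sym connect_adj_del.
Qed.

Lemma nonbridge_coverable b : b \notin bridges G -> coverable s t b.
Proof.
move=> /nonbridge_connect/connect_div[q [qX dq]].
exists (fun e => 1 *+ (e == b) + - q e); split=> [v|].
  by rewrite divD divN div_single dq subrr.
by rewrite eqxx qX ?subr0 // !inE negbK.
Qed.

Lemma bipartite_component b (x : del_edges [set b]) :
  bipartite (component x) <-> exists X : {set G}, forall e, e \in ~: [set b] ->
    connect (link s t (~: [set b])) x (s e) -> (s e \in X) != (t e \in X).
Proof.
set K : {set del_edges [set b]} := [set y | connect (@adj (del_edges [set b])) x y].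
have KE y : (y \in K) = connect (link s t (~: [set b])) x y.
  by rewrite inE connect_adj_del.
have := @bipartite_induced (del_edges [set b]) (s \o val) (t \o val) K
  (fun e => endsE (val e)).
rewrite /component -/K => ->; split=> -[X HX]; exists X => e.
  move=> eb cs; have eb' : e \notin [set b] by rewrite inE in eb.
  apply: (HX (Sub e eb' : {e | e \notin [set b]})); rewrite KE //.
  by rewrite /= -(component_closed s t x eb).
by rewrite /= !KE => cs _; apply: HX => //; rewrite inE (valP e).
Qed.

Lemma bipartite_side_not_magic b (x : del_edges [set b]) (A : zmodType) :
  b \in bridges G -> bipartite (component x) -> ~ zero_sum_magic A G.
Proof.
move=> /bridge_disconnects nst /bipartite_component[X HX] [phi [phi0 phiS]].
set L := link s t (~: [set b]) in nst HX.
(* Signs by side on the component of [x], and 0 elsewhere: every edge except [b] gets total weight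
   0. *)
pose w v : int := if connect L x v then (if v \in X then 1 else -1) else 0.
have := weighted_vsum s t phi w.
rewrite big1 => [|v _]; last by rewrite -vsum_ends phiS mul0rz.
rewrite (bigD1 b) //= [X in _ + X]big1 => [|e eb]; last first.
  have eX : e \in ~: [set b] by rewrite !inE.
  have cst := component_closed s t x eX.
  rewrite /w -cst; case: ifP => [cs|_]; last by rewrite addr0 mulr0z.
  by have := HX e eX cs; case: (s e \in X); case: (t e \in X).
have sgn v : phi b *~ (if v \in X then 1 else -1) != 0.
  by case: ifP; rewrite ?mulrN1z ?oppr_eq0 ?mulr1z.
have symL : connect_sym L by apply: connect_link_sym.
rewrite addr0 /w => /esym/eqP; apply/negP.
(* As [b] is a bridge, exactly one of its ends lies in the component of [x]. *)
case cs: (connect L x (s b)); case ct: (connect L x (t b)).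
- by case/negP: nst; apply: (@connect_trans G L x) ct; rewrite symL.
- by rewrite addr0.
- by rewrite add0r.
- by case: (del_connect b x); rewrite symL ?cs ?ct.
Qed.

Lemma nonbipartite_bridge_label (R : pzRingType) b :
    (forall x : del_edges [set b], ~ bipartite (component x)) ->
  exists phi : edge G -> R, (forall v, vsum s t phi v = 0) /\ phi b = 2%:R.
Proof.
move=> nbip.
have psi x : exists psi : edge G -> R,
    (forall e, e \notin ~: [set b] -> psi e = 0) /\
    (forall v, vsum s t psi v = 2%:R *+ (x == v)).
  by apply: nonbipartite_vsum => /(bipartite_component x)/nbip.
have [p1 [p1b d1]] := psi (s b); have [p2 [p2b d2]] := psi (t b).
(* [p1] and [p2] vanish on [b], so its label is exactly 2. *)
exists (fun e => 2%:R *+ (e == b) + - (p1 e + p2 e)); split=> [v|].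
  by rewrite vsumD vsumN vsumD vsum_single d1 d2 subrr.
by rewrite eqxx p1b ?p2b ?addr0 ?subr0 // !inE negbK.
Qed.

End Graphs.

(** * Labels modulo 2j and the assembly *)

Section Residues.
Local Open Scope ring_scope.

(** The values of [h] are read as the numbers 0 and 1. Since [c + c = 0], the map sending [a] to
    [c *+ a] is additive, and signs do not matter in its image. *)
Lemma vsum_F2 (V E : finType) (s t : E -> V) (R : pzRingType) (c : R)
    (h : E -> 'F_2) v :
  c + c = 0 -> flow s t h -> vsum s t (fun e => c *+ h e) v = 0.
Proof.
move=> cc fh.
have cD : {morph (fun a : 'F_2 => c *+ a) : a b / a + b >-> a + b}.
  by case=> [[|[|//]] la] [[|[|//]] lb]; rewrite /= ?addr0 ?add0r ?cc.
have -> : vsum s t (fun e => c *+ h e) v = c *+ (div s t h v); last by rewrite fh.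
have c0 : c *+ (0%R : 'F_2) = 0 by [].
rewrite (big_morph _ cD c0); apply: eq_bigr => e _.
have := cD (h e) (h e); rewrite F2_addxx mulr0n => hh.
case: (s e == v); case: (t e == v); rewrite ?mulr1n ?mulr0n ?subrr ?subr0 ?addr0 ?mulr0n -?hh //.
rewrite sub0r add0r; congr (c *+ _); apply/congr1/eqP.
by rewrite -addr_eq0 F2_addxx.
Qed.

(** Serves for the labels 2 and [j]; the label 2 is nonzero because 2 < 2j. *)
Lemma Z2j_natr_neq0 (j k : nat) : (1 < j)%N -> (0 < k < 2 * j)%N -> (k%:R : 'Z_(2 * j)) != 0.
Proof.
move=> j1 /andP[k0 kj]; rewrite -val_eqE /= val_Zp_nat; last by lia.
by rewrite modn_small // -lt0n.
Qed.

End Residues.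

Lemma le_zeta j G c : 0 < c -> zero_sum_magic 'rV['Z_(2 * j)]_c G ->
  le_nat_infty (zeta j G) c.
Proof.
move=> c0 mG; rewrite /zeta; case: pselect => [exP|]; last first.
  by case; exists c; apply/asboolP.
by rewrite /=; case: ex_minnP => m _; apply; apply/asboolP.
Qed.

Theorem theorem3p1 (j : nat) (hj : 2 <= j) (G : mgraph) (hG : connected G)
    (hB : bridges G != set0) :
  (~ (exists b : edge G, b \in bridges G /\
        exists x : del_edges [set b],
          bipartite (component x) \/ isomorphic (component x) K1) ->
     le_nat_infty (zeta j G) (3 + #|bridges G|))
  /\
  ((exists b : edge G, b \in bridges G /\
        exists x : del_edges [set b],
          bipartite (component x) \/ isomorphic (component x) K1) ->
     ~ (exists A : finZmodType, 1 < #|A| /\ zero_sum_magic A G)).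
Proof.
have [s [t st]] := ends_fun G.
have nloop e : s e != t e by have [] := st e.
have endsE e : ends e = [set s e; t e] by have [] := st e.
split=> [nbip|[b [bB [x bip]]] [A [_ mA]]]; last first.
  apply: (bipartite_side_not_magic nloop endsE hG bB _ mA (x := x)).
  by case: bip => // /K1_bipartite.
apply: le_zeta => //.
have [phi [fphi cphi]] := eight_flow s t.
have /choice[L HL] (i : 'I_#|bridges G|) : exists L : edge G -> 'Z_(2 * j),
    (forall v, vsum s t L v = 0%R) /\ L (enum_val i) = 2%:R%R.
  apply: (nonbipartite_bridge_label nloop endsE) => x bip; apply: nbip.
  by exists (enum_val i); split; [exact: enum_valP|exists x; left].
pose c : 'Z_(2 * j) := j%:R%R.
have cc : (c + c = 0)%R.
  by rewrite /c -natrD addnn -mul2n pchar_Zp //; lia.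
(* Three coordinates carry [j] times the 8-flow and make the non-bridges nonzero; each bridge has
   its own further coordinate, where its label is 2. *)
pose psi e : 'rV['Z_(2 * j)]_(3 + #|bridges G|) :=
  row_mx (\row_i (c *+ phi e ord0 i)%R) (\row_i L i e).
exists psi; split=> [e|v].
  rewrite row_mx_eq0 negb_and; have [eB|eB] := boolP (e \in bridges G).
    apply/orP; right; apply/rV0Pn; exists (enum_rank_in eB e); rewrite mxE.
    have [_ ] := HL (enum_rank_in eB e); rewrite enum_rankK_in // => ->.
    by apply: Z2j_natr_neq0; lia.
  have /rV0Pn[i /F2_neq0 phii] := cphi e (nonbridge_coverable nloop endsE hG eB).
  apply/orP; left; apply/rV0Pn; exists i; rewrite mxE phii.
  by apply: Z2j_natr_neq0; lia.
rewrite (vsum_ends nloop endsE); apply/rowP => i; rewrite mxE summxE.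
case: (split_ordP i) => k ->.
  rewrite -[RHS](vsum_F2 v cc (flow_coord k fphi)); apply: eq_bigr => e _.
  by rewrite mxE !mulmxnE row_mxEl mxE.
have [dL _] := HL k; rewrite -[RHS](dL v); apply: eq_bigr => e _.
by rewrite mxE !mulmxnE row_mxEr mxE.
Qed.
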